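(* Let $G$ be a tree with node set $[p]$, and let $G^\circ$ be the induced subgraph of $G$ on its interior nodes (the nodes that are not leaves). Then the stable set polytope $\operatorname{STAB}(G^\circ)$ is unimodularly equivalent to a face of $\operatorname{CIM}_G$.
   Context: $[p]=\{1,\dots,p\}$. A leaf of a tree is a node with a unique neighbour. For a DAG $\mathcal D$ on $[p]$ the characteristic imset $c_{\mathcal D}$ is the vector indexed by all $S\subseteq[p]$, $|S|\ge2$, with $c_{\mathcal D}(S)=1$ if there is $i\in S$ such that all elements of $S\setminus\{i\}$ are parents of $i$ in $\mathcal D$, and $0$ otherwise. $\operatorname{CIM}_G=\operatorname{conv}(c_{\mathcal D}:\mathcal D\text{ a DAG on }[p]\text{ with skeleton (underlying undirected graph) }G)$. For an undirected graph $K$ with node set $V$, a set $S\subseteq V$ is stable if no two nodes of $S$ are joined by an edge, and $\operatorname{STAB}(K)=\operatorname{conv}(\chi_S: S\text{ stable in }K)\subseteq\mathbb R^V$, where $\chi_S$ is the $0/1$ incidence vector of $S$. Two lattice polytopes $P\subset\mathbb R^m$, $Q\subset\mathbb R^n$ are unimodularly equivalent if there is an affine bijection between their affine hulls mapping $P$ onto $Q$ and mapping the lattice points $\operatorname{aff}(P)\cap\mathbb Z^m$ bijectively onto $\operatorname{aff}(Q)\cap\mathbb Z^n$.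
   Formalization: The tree is assumed to have at least two nodes: for the one-node tree the node is not a leaf, so STAB(G°) is the segment [0,1] while CIM_G is a single point, and the claim as stated fails. *)

(* Defs.v *)
From HB Require Import structures.
From mathcomp Require Import all_boot all_order all_algebra.
From mathcomp Require Import all_classical all_reals.

Set Implicit Arguments.
Unset Strict Implicit.
Unset Printing Implicit Defensive.

Import Order.TTheory GRing.Theory Num.Theory.
Local Open Scope classical_set_scope.
Local Open Scope ring_scope.

Section Graphs.
Variables (T : finType) (e : rel T).

Definition simple_graph : Prop := symmetric e /\ irreflexive e.

(* A [ucycle] of size 2 is an edge traversed back and forth, and [ucycle]s of
   size 1 are loops, hence the bound on the size. *)
Definition is_tree : Prop :=
  [/\ simple_graph,
      (0 < #|T|)%N,
      forall x y : T, connect e x y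
    & forall c : seq T, ucycle e c -> (size c <= 2)%N].

Definition leaf (i : T) : bool := #|e i| == 1%N.

Definition interior : finType := {i : T | ~~ leaf i}.

Definition interior_graph : rel interior := fun i j => e (val i) (val j).

Definition stable (S : {set T}) : bool :=
  [forall i in S, forall j in S, ~~ e i j].

(* [e i j] read as an arc from i to j; [ucycle]s of size 1 and 2 are then
   genuine directed cycles. *)
Definition is_dag : Prop := forall c : seq T, ucycle e c -> c = [::].

Definition skeleton : rel T := fun i j => e i j || e j i.

End Graphs.

Arguments interior_graph {T} e.

Section Polytopes.
Variable R : realType.

Definition dotv (I : finType) (a x : {ffun I -> R^o}) : R := \sum_i a i * x i.

Definition conv_hull (V : lmodType R) (A : set V) : set V :=
  [set x | exists (n : nat) (w : 'I_n -> R) (v : 'I_n -> V),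
    [/\ forall k, 0 <= w k, \sum_k w k = 1, forall k, A (v k)
      & x = \sum_k w k *: v k]].

Definition aff_hull (V : lmodType R) (A : set V) : set V :=
  [set x | exists (n : nat) (w : 'I_n -> R) (v : 'I_n -> V),
    [/\ \sum_k w k = 1, forall k, A (v k) & x = \sum_k w k *: v k]].

Definition affine_on (V W : lmodType R) (A : set V) (f : V -> W) : Prop :=
  forall (x y : V) (t : R), A x -> A y ->
    f (t *: x + (1 - t) *: y) = t *: f x + (1 - t) *: f y.

Definition lattice (I : finType) : set {ffun I -> R^o} :=
  [set x | forall i, (x i : R) \is a Num.int].
Arguments lattice : clear implicits.

(* The values of [f] outside [aff_hull P] are irrelevant. *)
Definition unimodularly_equivalent (I J : finType)
    (P : set {ffun I -> R^o}) (Q : set {ffun J -> R^o}) : Prop :=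
  exists f : {ffun I -> R^o} -> {ffun J -> R^o},
    [/\ affine_on (aff_hull P) f,
        set_bij (aff_hull P) (aff_hull Q) f,
        f @` P = Q
      & set_bij (aff_hull P `&` lattice I) (aff_hull Q `&` lattice J) f].

Definition is_face (I : finType) (F P : set {ffun I -> R^o}) : Prop :=
  exists (a : {ffun I -> R^o}) (b : R),
    (forall x, P x -> dotv a x <= b) /\ F = [set x | P x /\ dotv a x = b].

Definition incidence_vector (T : finType) (S : {set T}) : {ffun T -> R^o} :=
  [ffun i => (i \in S)%:R].

Definition STAB (T : finType) (e : rel T) : set {ffun T -> R^o} :=
  conv_hull [set incidence_vector S | S in [set S | stable e S]].

Definition imset_index (p : nat) : finType := {S : {set 'I_p} | (1 < #|S|)%N}.

Definition characteristic_imset (p : nat) (d : rel 'I_p) :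
    {ffun imset_index p -> R^o} :=
  [ffun S : imset_index p =>
     ([exists i in val S, forall j in val S :\ i, d j i] : bool)%:R].

Definition CIM (p : nat) (e : rel 'I_p) : set {ffun imset_index p -> R^o} :=
  conv_hull [set characteristic_imset d |
             d in [set d : rel 'I_p | is_dag d /\ skeleton d =2 e]].

End Polytopes.

Arguments STAB R {T} e.
Arguments CIM R {p} e.

(* Main.v *)
(* In a tree the only sets of size at least 3 on which a characteristic imset can
   be nonzero are the stars, each with a unique centre i, and the value at
   {i} + A is 1 iff A consists of parents of i. The linear form
     sum over i and neighbours j <> k of i of (x_{i + N(i)} - x_{i, j, k})
   is therefore nonpositive on CIM_G, and it vanishes exactly at the orientations
   in which a node with at least two parents has all its neighbours as parents.
   The nodes which absorb all their neighbours then form a stable set of interior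
   nodes, which determines the imset: its value at a star of size at least 3 is
   the indicator of the centre. Every stable set S arises: root the tree, orient
   the edges away from the root, then redirect those at S towards S. *)
Require Import Defs.
From mathcomp Require Import all_boot all_order all_algebra.
From mathcomp Require Import all_classical all_reals.

Set Implicit Arguments.
Unset Strict Implicit.
Unset Printing Implicit Defensive.

Import Order.TTheory GRing.Theory Num.Theory.
Local Open Scope ring_scope.

(** * Affine maps, hulls, faces and lattice points *)

Definition preserves_affine_combinations (R : realType) (V W : lmodType R)
    (f : V -> W) : Prop :=
  forall (n : nat) (w : 'I_n -> R) (v : 'I_n -> V), \sum_k w k = 1 ->
    f (\sum_k w k *: v k) = \sum_k w k *: f (v k).

Lemma preserves_affine_on (R : realType) (V W : lmodType R) (f : V -> W)
    (A : set V) : preserves_affine_combinations f -> affine_on A f.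
Proof.
move=> hf x y t _ _.
have := hf 2%N (fun k => if k == ord0 then t else 1 - t)
  (fun k => if k == ord0 then x else y).
by rewrite !big_ord_recl !big_ord0 /= !addr0 addrC subrK; apply.
Qed.

Lemma conv_hull_image (R : realType) (V W : lmodType R) (f : V -> W)
    (A : set V) : preserves_affine_combinations f ->
  (f @` conv_hull A = conv_hull (f @` A))%classic.
Proof.
move=> hf; apply/seteqP; split=> [_ [_ [n [w [v [w0 w1 Av ->]]]] <-]|].
  exists n, w, (f \o v); split=> //; last exact: hf.
  by move=> k; exists (v k).
move=> _ [n [w [v [w0 w1 fAv ->]]]].
have /boolp.choice[u fu] k : exists u, A u /\ f u = v k.
  by have [u] := fAv k; exists u.
exists (\sum_k w k *: u k).
  by exists n, w, u; split=> // k; have [] := fu k.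
by rewrite hf //; apply: eq_bigr => k _; have [_ ->] := fu k.
Qed.

Lemma aff_hull_image (R : realType) (V W : lmodType R) (f : V -> W)
    (A : set V) : preserves_affine_combinations f ->
  (f @` aff_hull A = aff_hull (f @` A))%classic.
Proof.
move=> hf; apply/seteqP; split=> [_ [_ [n [w [v [w1 Av ->]]]] <-]|].
  exists n, w, (f \o v); split=> //; last exact: hf.
  by move=> k; exists (v k).
move=> _ [n [w [v [w1 fAv ->]]]].
have /boolp.choice[u fu] k : exists u, A u /\ f u = v k.
  by have [u] := fAv k; exists u.
exists (\sum_k w k *: u k).
  by exists n, w, u; split=> // k; have [] := fu k.
by rewrite hf //; apply: eq_bigr => k _; have [_ ->] := fu k.
Qed.

(** As [f] is affine on the whole space it commutes with hulls, and its injectivity and lattice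
    condition restrict to any affine hull. *)
Lemma unimodularly_equivalent_image (R : realType) (I J : finType)
    (f : {ffun I -> R^o} -> {ffun J -> R^o}) (P : set {ffun I -> R^o}) :
  preserves_affine_combinations f -> injective f ->
  (forall x, @lattice R J (f x) <-> @lattice R I x) ->
  unimodularly_equivalent P (f @` P)%classic.
Proof.
move=> hf f_inj f_lat; exists f; rewrite -aff_hull_image //.
split=> //; first exact: preserves_affine_on.
- split; [by move=> x Px; exists x|by move=> x y _ _ /f_inj|by []].
- split; last 1 first.
  + by move=> _ [[x Px <-] /f_lat Lx]; exists x.
  + by move=> x [Px Lx]; split; [exists x|apply/f_lat].
  + by move=> x y _ _ /f_inj.
Qed.

Lemma combination_coord (R : realType) (I : finType) (n : nat) (w : 'I_n -> R)
    (v : 'I_n -> {ffun I -> R^o}) (i : I) :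
  (\sum_k w k *: v k) i = \sum_k w k * v k i.
Proof. by rewrite sum_ffunE; apply: eq_bigr => k _; rewrite ffunE. Qed.

Lemma dotv_combination (R : realType) (I : finType) (a : {ffun I -> R^o})
    (n : nat) (w : 'I_n -> R) (v : 'I_n -> {ffun I -> R^o}) :
  dotv a (\sum_k w k *: v k) = \sum_k w k * dotv a (v k).
Proof.
rewrite /dotv; under eq_bigr => i _ do rewrite combination_coord mulr_sumr.
rewrite exchange_big; apply: eq_bigr => k _; rewrite mulr_sumr.
by apply: eq_bigr => i _; rewrite mulrCA.
Qed.

(* A convex combination attains the maximum of a linear form only if all the
   points of positive weight do; the points of weight zero can be replaced. *)
Lemma conv_hull_face (R : realType) (I : finType) (A : set {ffun I -> R^o})
    (a : {ffun I -> R^o}) (b : R) :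
  (forall v, A v -> dotv a v <= b) ->
  is_face (conv_hull [set v | A v /\ dotv a v = b])%classic (conv_hull A).
Proof.
move=> ab; exists a, b; split=> [_ [n [w [v [w0 w1 Av ->]]]]|].
  rewrite dotv_combination -[b]mul1r -w1 mulr_suml.
  by apply: ler_sum => k _; apply: ler_wpM2l (ab _ (Av k)).
apply/seteqP; split=> [_ [n [w [v [w0 w1 Av ->]]]]|].
  split; first by exists n, w, v; split=> // k; have [] := Av k.
  rewrite dotv_combination -[b]mul1r -w1 mulr_suml.
  by apply: eq_bigr => k _; have [_ ->] := Av k.
move=> _ [[n [w [v [w0 w1 Av ->]]]]]; rewrite dotv_combination => wb.
have tight k : w k != 0 -> dotv a (v k) = b.
  have /eqP : \sum_k w k * (b - dotv a (v k)) = 0.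
    under eq_bigr => l _ do rewrite mulrBr.
    by rewrite sumrB -mulr_suml w1 mul1r wb subrr.
  rewrite psumr_eq0 => [/allP/(_ k (mem_index_enum k))|l _]; last first.
    by rewrite mulr_ge0 ?subr_ge0 ?ab.
  by rewrite mulf_eq0 subr_eq0 => /orP[->//|/eqP->].
have [k0 wk0] : exists k, w k != 0.
  apply: contrapT => /forallNP w_eq0; move/eqP: w1.
  rewrite big1 ?(eq_sym 0) ?oner_eq0 // => k _.
  by apply/eqP/negbNE/negP/w_eq0.
exists n, w, (fun k => if w k == 0 then v k0 else v k); split=> //.
  by move=> k; case: ifPn => [_|/tight]; split=> //; exact: tight.
by apply: eq_bigr => k _; case: ifPn => // /eqP->; rewrite !scale0r.
Qed.

(** * Trees and their rooted orientations *)

Lemma tree_no_triangle (T : finType) (e : rel T) (x y z : T) :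
  is_tree e -> e x y -> e y z -> e z x -> False.
Proof.
move=> [[es ei] _ _ ac] xy yz zx.
have neq u v : e u v -> u != v by apply: contraTneq => ->; rewrite ei.
have /ac // : ucycle e [:: x; y; z].
by rewrite /ucycle /= xy yz zx !inE negb_or (neq x) // eq_sym (neq z) // (neq y).
Qed.

(** A cycle of [d] is a cycle of [e], so it has at most two nodes; asymmetry rules out loops and
    two-cycles. *)
Lemma tree_asym_is_dag (T : finType) (e d : rel T) :
  is_tree e -> subrel d e -> (forall x y, d x y -> ~~ d y x) -> is_dag d.
Proof.
move=> [[es ei] _ _ ac] de asym c /andP[cc uc].
have : (size c <= 2)%N.
  apply: ac; rewrite /ucycle uc andbT.
  by case: c cc {uc} => //= x c; apply: sub_path.
case: c cc {uc} => [|x [|y [|]]] //=; rewrite !andbT.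
  by move=> /[dup] /asym /negP.
by move=> /andP[/asym/negbTE->].
Qed.

(** With a second node present, connectedness gives every node a neighbour, and a non-leaf then has
    at least two. A lone node would count as interior. *)
Lemma interior_neighbours (T : finType) (e : rel T) (i : interior e) :
  (1 < #|T|)%N -> is_tree e ->
  exists j k, [/\ e j (val i), e k (val i) & j != k].
Proof.
case: i => i /= ileaf cT [[es _] _ conn _].
have /card_gt1P[j [k [ij ik jk]]] : (1 < #|e i|)%N.
  rewrite ltn_neqAle eq_sym ileaf /=.
  have [y yi] : exists y, y != i.
    have /card_gt1P[x [y [_ _ xy]]] := cT.
    by have [xi|xi] := eqVneq x i; [exists y; rewrite -xi eq_sym|exists x].
  have /connectP[[|z s] /= ez ey] := conn i y; first by rewrite ey eqxx in yi.
  by apply/card_gt0P; exists z; case/andP: ez.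
by exists j, k; split=> //; rewrite es.
Qed.

(* [x] is the parent of [y] in the tree rooted at [r] when [r] is connected to
   [x] without using [y]. *)
Definition avoid (T : finType) (e : rel T) (y : T) : rel T :=
  fun u v => [&& e u v, u != y & v != y].

(** If [x] and [x'] differed, a simple path between them off [y] would close up through [y] to a
    cycle with at least three nodes. *)
Lemma avoid_unique (T : finType) (e : rel T) (r x x' y : T) : is_tree e ->
  e x y -> e x' y -> connect (avoid e y) r x -> connect (avoid e y) r x' ->
  x = x'.
Proof.
move=> [[es ei] _ _ ac] xy x'y rx rx'; apply/eqP/negPn/negP => xx'.
have symA : symmetric (avoid e y).
  by move=> u v; rewrite /avoid es; congr andb; rewrite andbC.
have : connect (avoid e y) x x'.
  by apply: connect_trans rx'; rewrite (sym_connect_sym symA).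
case/connectP=> s0 /shortenP[s sA us _ x's].
have yNs : y \notin x :: s.
  rewrite inE negb_or; apply/andP; split.
    by apply: contraTneq xy => ->; rewrite ei.
  elim: s x sA {us x's rx xx' xy} => //= z s IHs x /andP[/and3P[_ _ zy]] /IHs.
  by rewrite inE negb_or eq_sym zy.
have : (size (y :: x :: s) <= 2)%N.
  apply: ac; rewrite /ucycle cons_uniq yNs us !andbT /= es xy /= rcons_path.
  rewrite -x's x'y andbT; apply: sub_path sA.
  by move=> u v /and3P[].
by case: s x's {sA us yNs} => //= x's; rewrite x's eqxx in xx'.
Qed.

(** Take a simple path from [r] to [x]: either it misses [y], or its initial segment up to [y]
    misses [x]. *)
Lemma avoid_total (T : finType) (e : rel T) (r x y : T) : is_tree e ->
  e x y -> connect (avoid e y) r x || connect (avoid e x) r y.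
Proof.
move=> [[es ei] _ conn _] xy.
have reach s z : path e r s -> z \notin r :: s -> connect (avoid e z) r (last r s).
  move=> es' zs; apply/connectP; exists s => //.
  elim: s (r) es' zs => //= v s IHs u /andP[uv vs].
  rewrite !inE !negb_or => /and3P[zu zv zs].
  by rewrite /avoid uv eq_sym zu eq_sym zv /= IHs // inE negb_or zv.
case/connectP: (conn r x) => s0 /shortenP[s rs us _ xs].
have [ys|yNs] := boolP (y \in r :: s); last by rewrite xs reach.
apply/orP; right.
case/splitPl: ys rs us xs => s1 s2 y_last.
rewrite cat_path last_cat -cat_cons cat_uniq y_last => /andP[rs1 _].
case/and3P=> _ /hasPn s12 _ xs; rewrite -y_last reach //.
apply: s12; have := mem_last y s2; rewrite -xs inE => /orP[/eqP exy|//].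
by rewrite exy ei in xy.
Qed.

Lemma tree_rooted_orientation (n : nat) (e : rel 'I_n) : is_tree e ->
  exists o : rel 'I_n,
    [/\ subrel o e, forall x y, e x y -> o x y || o y x,
        forall x y, o x y -> ~~ o y x
      & forall x x' y, o x y -> o x' y -> x = x'].
Proof.
move=> te; have [[es ei] /card_gt0P[r _] _ _] := te.
pose c x y := connect (avoid e y) r x.
(* The order on labels decides should both [c x y] and [c y x] hold, which makes asymmetry
   immediate. *)
exists (fun x y => [&& e x y, c x y & c y x ==> (x < y)%N]).
split=> [x y /and3P[] //|x y xy|x y|x x' y].
- have := avoid_total r te xy; rewrite -/(c x y) -/(c y x) (es y x) xy /=.
  have : x != y :> nat.
    by apply: contraTneq xy => /val_inj->; rewrite ei.
  by case: (c x y); case: (c y x) => //=; case: ltngtP.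
- move=> /and3P[_ cxy] h; apply/negP => /and3P[_ cyx].
  by move: h; rewrite cxy cyx /=; case: ltngtP.
- by move=> /and3P[xy cx _] /and3P[x'y cx' _]; apply: avoid_unique cx cx'.
Qed.

(** * Saturated orientations and stable sets *)

(* The DAGs whose characteristic imset lies on the face. *)
Definition saturated (T : finType) (e d : rel T) : Prop :=
  forall i j k, d j i -> d k i -> j != k -> forall l, e l i -> d l i.

Definition sinks (T : finType) (e d : rel T) : {set interior e} :=
  [set i | [forall j, e j (val i) ==> d j (val i)]].

Lemma sinks_stable (T : finType) (e d : rel T) :
  is_tree e -> (forall x y, d x y -> ~~ d y x) ->
  stable (interior_graph e) (sinks e d).
Proof.
move=> [[es _] _ _ _] asym.
apply/forall_inP => i; rewrite inE => /forallP ai.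
apply/forall_inP => j; rewrite inE => /forallP aj.
rewrite /interior_graph; apply/negP => ij.
have := aj (val i); rewrite ij => /asym.
by have := ai (val j); rewrite es ij /= => ->.
Qed.

Lemma dag_asym (T : finType) (e d : rel T) : irreflexive e ->
  is_dag d -> subrel d e -> forall x y, d x y -> ~~ d y x.
Proof.
move=> ei dag de x y xy; apply/negP => yx.
have // : [:: x; y] = [::].
apply: dag; rewrite /ucycle /= xy yx inE !andbT.
by apply: contraTneq (de _ _ xy) => ->; rewrite ei.
Qed.

Lemma stable_sinks (n : nat) (e : rel 'I_n) (S : {set interior e}) :
  (1 < n)%N -> is_tree e -> stable (interior_graph e) S ->
  exists d : rel 'I_n,
    [/\ is_dag d, skeleton d =2 e, saturated e d & sinks e d = S].
Proof.
move=> n1 te stS; have [[es ei] _ _ _] := te.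
have [o [oe ot oa ou]] := tree_rooted_orientation te.
pose T := val @: S.
have stT x y : e x y -> x \in T -> y \notin T.
  move=> xy /imsetP[i iS ex]; apply/imsetP=> -[j jS ey].
  by have /forall_inP/(_ i iS)/forall_inP/(_ j jS)/negP := stS; apply;
    rewrite /interior_graph -ex -ey.
(* Edges meeting [T] point into [T]; all others follow [o]. *)
pose d x y := [&& e x y, x \notin T & (y \in T) || o x y].
(* Outside [T] every incoming arc comes from [o], which allows one parent per node. *)
have d1 j k i : d j i -> d k i -> j != k -> i \in T.
  move=> /and3P[_ _] /orP[//|ji] /and3P[_ _] /orP[//|ki].
  by rewrite (ou _ _ _ ji ki) eqxx.
exists d; split.
- apply: (tree_asym_is_dag te) => [x y /and3P[]//|x y /and3P[xy xT h]].
  rewrite /d (negbTE xT) /= es xy /=.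
  by case/orP: h => [->//|/oa/negbTE->]; rewrite andbF.
- move=> x y; rewrite /skeleton /d (es y x); case xy: (e x y) => //=.
  have yNT := stT _ _ xy; have oxy := ot _ _ xy.
  have [xT|_] := boolP (x \in T); first by rewrite yNT.
  by case: (y \in T).
- move=> i j k ji ki jk l li.
  have iT := d1 _ _ _ ji ki jk.
  by rewrite /d li iT orTb andbT; apply: (stT i) => //; rewrite es.
apply/setP => i; rewrite inE -(mem_imset S i val_inj) -/T.
(* An interior node has two distinct neighbours; if it absorbs both, [d1] puts it in [T]. *)
apply/forallP/idP => [all|iT j].
  have [||j [k [ji ki jk]]] := @interior_neighbours _ e i; rewrite ?card_ord //.
  apply: (d1 j k) => //; [have := all j|have := all k];
  by rewrite ?ji ?ki.
by apply/implyP => ji; rewrite /d ji iT orTb andbT; apply: (stT (val i));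
   rewrite // es.
Qed.

(** * Stars and their centres *)

Definition has_centre (T : finType) (d : rel T) (S : {set T}) : bool :=
  [exists i in S, [forall j in S :\ i, d j i]].

Definition star (T : finType) (e : rel T) (i : T) (S : {set T}) : bool :=
  (i \in S) && [forall j in S :\ i, e j i].

Lemma has_centre_sub (T : finType) (e d : rel T) (S : {set T}) :
  subrel d e -> has_centre d S -> exists i, star e i S.
Proof.
move=> de /exists_inP[i iS /forall_inP all]; exists i; rewrite /star iS /=.
by apply/forall_inP => j /all /de.
Qed.

Lemma card_gt2_pair (T : finType) (S : {set T}) (i : T) : (2 < #|S|)%N ->
  i \in S -> exists j k, [/\ j \in S :\ i, k \in S :\ i & j != k].
Proof.
rewrite (cardsD1 i) => + iS; rewrite iS add1n ltnS => /card_gt1P[j [k [jS kS jk]]].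
by exists j, k.
Qed.

(** Two distinct centres are adjacent, and a third element of [S] would form a triangle with
    them. *)
Lemma star_unique (T : finType) (e : rel T) (i j : T) (S : {set T}) :
  is_tree e -> (2 < #|S|)%N -> star e i S -> star e j S -> i = j.
Proof.
move=> te S2 /andP[iS /forall_inP ai] /andP[jS /forall_inP aj].
have [[es ei] _ _ _] := te.
apply/eqP/negPn/negP => ij.
have [k [l [+ + kl]]] := card_gt2_pair S2 iS; rewrite !inE => /andP[ki kS] /andP[li lS].
have ji : e j i by apply: ai; rewrite !inE eq_sym ij.
have third m : m != i -> m \in S -> m = j.
  move=> mi mS; apply/eqP/negPn/negP => mj.
  apply: (tree_no_triangle te ji (y := i) (z := m)).
    by rewrite es ai // !inE mi.
  by apply: aj; rewrite !inE mj.
by move: kl; rewrite (third k) // (third l) // eqxx.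
Qed.

(** Any centre for [d] is also a star centre for [e], hence equal to [i] by [star_unique]. *)
Lemma has_centre_star (T : finType) (e d : rel T) (i : T) (S : {set T}) :
  is_tree e -> subrel d e -> (2 < #|S|)%N -> star e i S ->
  has_centre d S = [forall j in S :\ i, d j i].
Proof.
move=> te de S2 si; have /andP[iS _] := si.
apply/exists_inP/idP => [[j jS dj]|di]; last by exists i.
have sj : star e j S.
  by rewrite /star jS /=; apply/forall_inP => k /(forall_inP dj)/de.
by rewrite (star_unique te S2 si sj).
Qed.

(** * The affine lift from node vectors to imsets *)

(* A set of size at least 3 has at most one star centre, so the sum below has at
   most one term. *)
Definition imset_lift (R : realType) (p : nat) (G : rel 'I_p)
    (x : {ffun interior G -> R^o}) : {ffun imset_index p -> R^o} :=
  [ffun S : imset_index p => if #|val S| == 2%N then (has_centre G (val S))%:R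
    else \sum_(i : interior G | star G (val i) (val S)) x i].

Lemma imset_lift_affine (R : realType) (p : nat) (G : rel 'I_p) :
  preserves_affine_combinations (@imset_lift R p G).
Proof.
move=> n w v w1; apply/ffunP => S; rewrite combination_coord ffunE.
under [RHS]eq_bigr => k _ do rewrite ffunE.
(* On pairs the lift is constant, and a constant is preserved because the weights sum to 1. *)
case: ifP => _; first by rewrite -mulr_suml w1 mul1r.
under [LHS]eq_bigr => i _ do rewrite combination_coord.
by rewrite exchange_big; apply: eq_bigr => k _; rewrite mulr_sumr.
Qed.

Definition closed_nbhd (T : finType) (e : rel T) (i : T) : {set T} :=
  i |: [set j | e j i].

Lemma star_closed_nbhd (T : finType) (e : rel T) (i : T) :
  star e i (closed_nbhd e i).
Proof.
rewrite /star !inE eqxx /=; apply/forall_inP => j.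
by rewrite !inE => /andP[/negbTE->].
Qed.

Lemma card_cherry (T : finType) (e : rel T) (i j k : T) (S : {set T}) :
  irreflexive e -> e j i -> e k i -> j != k ->
  i \in S -> j \in S -> k \in S -> (2 < #|S|)%N.
Proof.
move=> ei ji ki jk iS jS kS; apply/card_gt2P; exists i, j, k; split=> //.
have ne l : e l i -> l != i by apply: contraTneq => ->; rewrite ei.
by rewrite jk eq_sym !ne.
Qed.

(** Take the closed neighbourhood of [i]: it has at least three elements and [i] is its only star
    centre. Reading off [x i] there gives injectivity and recovers integrality. *)
Lemma imset_lift_nbhd (R : realType) (p : nat) (G : rel 'I_p) (i : interior G) :
  (1 < p)%N -> is_tree G ->
  exists S : imset_index p, forall x, @imset_lift R p G x S = x i.
Proof.
move=> p1 tG; have [[es ei] _ _ _] := tG.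
have N2 : (2 < #|closed_nbhd G (val i)|)%N.
  have [||j [k [ji ki jk]]] := @interior_neighbours _ G i; rewrite ?card_ord //.
  by apply: (card_cherry ei ji ki jk); rewrite !inE ?eqxx ?ji ?ki ?orbT.
exists (Sub (closed_nbhd G (val i)) (ltnW N2) : imset_index p) => x; rewrite ffunE /= gtn_eqF //.
rewrite (big_pred1 i) // => j /=; apply/idP/eqP => [sj|->].
  exact/val_inj/(star_unique tG N2 sj)/star_closed_nbhd.
exact: star_closed_nbhd.
Qed.

Lemma imset_lift_inj (R : realType) (p : nat) (G : rel 'I_p) :
  (1 < p)%N -> is_tree G -> injective (@imset_lift R p G).
Proof.
move=> p1 tG x y xy; apply/ffunP => i.
by have [S vS] := imset_lift_nbhd R i p1 tG; rewrite -!vS xy.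
Qed.

Lemma imset_lift_lattice (R : realType) (p : nat) (G : rel 'I_p)
    (x : {ffun interior G -> R^o}) : (1 < p)%N -> is_tree G ->
  @lattice R _ (imset_lift x) <-> @lattice R _ x.
Proof.
move=> p1 tG; split=> Lx i; last first.
  by rewrite ffunE; case: ifP => _; [case: has_centre|apply: rpred_sum].
by have [S <-] := imset_lift_nbhd R i p1 tG; apply: Lx.
Qed.

Lemma imset_lift_sinks (R : realType) (p : nat) (G d : rel 'I_p) :
  is_tree G -> skeleton d =2 G -> saturated G d ->
  imset_lift (incidence_vector R (sinks G d)) = characteristic_imset R d.
Proof.
move=> tG sk sat; have [[es ei] _ _ _] := tG.
have dG : subrel d G by move=> x y xy; rewrite -sk /skeleton xy.
apply/ffunP => -[S /= S1]; rewrite !ffunE /= -/(has_centre d S).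
have [/cards2P[x [y [xy ->]]]|S2] := ifPn.
  (* On a pair both sides tell whether it is an edge, as [skeleton d] agrees with [G]. *)
  congr (_%:R); congr nat_of_bool.
  have Dx : [set x; y] :\ x = [set y] by rewrite setU1K // inE.
  have Dy : [set x; y] :\ y = [set x] by rewrite finset.setUC setU1K // inE eq_sym.
  have pair f : has_centre f [set x; y] = f y x || f x y.
    apply/exists_inP/orP => [[i]|[h|h]].
    - rewrite !inE => /orP[]/eqP->; rewrite ?Dx ?Dy => /forall_inP h.
        by left; apply: h; rewrite inE.
      by right; apply: h; rewrite inE.
    - by exists x; rewrite ?inE ?eqxx // Dx; apply/forall_inP => z /set1P->.
    - by exists y; rewrite ?inE ?eqxx ?orbT // Dy; apply/forall_inP => z /set1P->.
  by rewrite !pair -!sk /skeleton (orbC (d x y)) orbb.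
have {S1 S2}S2 : (2 < #|S|)%N by rewrite ltn_neqAle eq_sym S2.
have [[i si]|nstar] := pselect (exists i, star G i S); last first.
  (* Without a star centre both sides are zero. *)
  rewrite big1 => [|i si]; last by case: nstar; exists (val i).
  case cS: (has_centre d S) => //.
  by case: nstar; apply: has_centre_sub dG cS.
have /andP[iS /forall_inP ai] := si.
have [j [k [jS kS jk]]] := card_gt2_pair S2 iS.
have ileaf : ~~ leaf G i.
  suff : (1 < #|G i|)%N by rewrite /leaf; case: #|_| => [|[]].
  by apply/card_gt1P; exists j, k; split=> //; rewrite unfold_in es ai.
rewrite (big_pred1 (Sub i ileaf : interior G)) => [|l /=]; last first.
  apply/idP/eqP => [sl|->//]; apply/val_inj; exact: star_unique tG S2 sl si.
rewrite ffunE inE /= (has_centre_star tG dG S2 si); congr (_%:R).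
congr nat_of_bool; apply/forallP/forall_inP => [all l lS|all l].
  by have := all l; rewrite ai.
(* The star contains two distinct parents [j] and [k] of [i], so saturation makes every neighbour a
   parent. *)
apply/implyP; apply: sat jk l; exact: all.
Qed.

(** * The supporting linear form and the face *)

(** Triples list the centre first; each pair of neighbours occurs in both orders, which only doubles
    the form. *)
Definition cherry (T : finType) (e : rel T) (t : T * T * T) : bool :=
  [&& e t.1.2 t.1.1, e t.2 t.1.1 & t.1.2 != t.2].

Definition cherry_set (T : finType) (t : T * T * T) : {set T} :=
  t.1.1 |: [set t.1.2; t.2].

(* On a characteristic imset the summand of the cherry [j -> i <- k] is
   -1 if [j] and [k] are parents of [i] but some neighbour of [i] is not, and
   0 otherwise. *)
Definition face_form (R : realType) (p : nat) (G : rel 'I_p) :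
    {ffun imset_index p -> R^o} :=
  [ffun S : imset_index p => \sum_(t | cherry G t)
     ((val S == closed_nbhd G t.1.1)%:R - (val S == cherry_set t)%:R)].

Lemma dotv_face_form (R : realType) (p : nat) (G d : rel 'I_p) :
  is_tree G -> subrel d G ->
  dotv (face_form R G) (characteristic_imset R d) =
  - \sum_(t | cherry G t)
      (d t.1.2 t.1.1 && d t.2 t.1.1 && ~~ [forall l, G l t.1.1 ==> d l t.1.1])%:R.
Proof.
move=> tG dG; have [[es ei] _ _ _] := tG.
have coord (A : {set 'I_p}) : (1 < #|A|)%N ->
    \sum_(S : imset_index p) (val S == A)%:R * characteristic_imset R d S
    = (has_centre d A)%:R.
  move=> A1; rewrite (bigD1 (Sub A A1 : imset_index p)) //= eqxx mul1r.
  rewrite big1 ?addr0 => [|S]; first by rewrite ffunE.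
  by rewrite -val_eqE /= => /negbTE->; rewrite mul0r.
rewrite /dotv; under eq_bigr => S _ do rewrite ffunE mulr_suml.
rewrite exchange_big -sumrN; apply: eq_bigr => -[[i j] k] /= /and3P[/= ji ki jk].
under eq_bigr => S _ do rewrite mulrBl.
have N2 : (2 < #|closed_nbhd G i|)%N.
  by apply: (card_cherry ei ji ki jk); rewrite !inE ?eqxx ?ji ?ki ?orbT.
have C2 : (2 < #|cherry_set (i, j, k)|)%N.
  by apply: (card_cherry ei ji ki jk); rewrite !inE ?eqxx ?orbT.
have ne l : G l i -> l != i by apply: contraTneq => ->; rewrite ei.
have sC : star G i (cherry_set (i, j, k)).
  rewrite /star !inE eqxx /=; apply/forall_inP => l.
  by rewrite !inE => /andP[/negbTE-> /= /orP[]/eqP->].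
rewrite sumrB !coord ?(ltnW N2) ?(ltnW C2) //.
rewrite (has_centre_star tG dG N2 (star_closed_nbhd _ _)).
rewrite (has_centre_star tG dG C2 sC).
have -> : [forall l in closed_nbhd G i :\ i, d l i] =
          [forall l, G l i ==> d l i].
  apply: eq_forallb => l; rewrite !inE.
  by have [->|] := eqVneq l i; rewrite ?ei.
have -> : [forall l in cherry_set (i, j, k) :\ i, d l i] = d j i && d k i.
  apply/forall_inP/andP => [h|[dj dk] l].
    by split; apply: h; rewrite !inE eqxx ?orbT ne.
  by rewrite !inE => /andP[/negbTE-> /= /orP[]/eqP->].
(* If all neighbours are parents, both values are 1 and cancel; otherwise only the cherry value
   remains. *)
case: (boolP [forall l, _]) => [/forallP all|_].
  by have := all j; have := all k; rewrite ji ki /= => -> ->; rewrite subrr oppr0.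
by rewrite andbT sub0r.
Qed.

(** A sum of nonnegative terms vanishes only if each does, and the term at [(i, j, k)] detects a
    failure of saturation at [i]. *)
Lemma face_form_saturated (R : realType) (p : nat) (G d : rel 'I_p) :
  is_tree G -> subrel d G ->
  dotv (face_form R G) (characteristic_imset R d) = 0 <-> saturated G d.
Proof.
move=> tG dG; rewrite dotv_face_form //; split=> [/eqP|sat]; last first.
  rewrite big1 ?oppr0 // => -[[i j] k] /and3P[/= _ _ jk].
  case: (boolP (_ && _)) => //= /andP[/andP[ji ki] /forallP []].
  by move=> l; apply/implyP/(sat i j k).
rewrite oppr_eq0 psumr_eq0 => [/allP vanish i j k ji ki jk l li|t _]; last first.
  by rewrite ler0n.
have := vanish (i, j, k) (mem_index_enum _).
rewrite /cherry /= (dG _ _ ji) (dG _ _ ki) jk ji ki /= pnatr_eq0 eqb0 negbK.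
by move=> /forallP/(_ l); rewrite li.
Qed.

(** Matches generators: as [imset_lift] commutes with convex hulls, the lifted stable set polytope
    is the hull of the imsets on which [face_form] vanishes. *)
Lemma stable_images_saturated (R : realType) (p : nat) (G : rel 'I_p) :
  (1 < p)%N -> is_tree G ->
  ([set imset_lift x | x in
     [set incidence_vector R S | S in [set S | stable (interior_graph G) S]]] =
   [set v | [set characteristic_imset R d |
             d in [set d | is_dag d /\ skeleton d =2 G]] v /\
            dotv (face_form R G) v = 0])%classic.
Proof.
move=> p1 tG; have [[es ei] _ _ _] := tG.
have sub d : skeleton d =2 G -> subrel d G.
  by move=> sk x y xy; rewrite -sk /skeleton xy.
apply/seteqP; split=> [_ [_ [S stS <-] <-]|_ [[d [dag sk] <-]] /= /face_form_saturated].
  have [d [dag sk sat <-]] := stable_sinks p1 tG stS.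
  rewrite imset_lift_sinks //; split; first by exists d.
  by apply/face_form_saturated => //; apply: sub.
move=> /(_ tG (sub _ sk)) sat.
exists (incidence_vector R (sinks G d)); last exact: imset_lift_sinks.
exists (sinks G d) => //=; apply: sinks_stable => //.
exact: dag_asym ei dag (sub _ sk).
Qed.

Theorem proposition3p10 (R : realType) (p : nat) (G : rel 'I_p)
    (hp : (1 < p)%N) (hG : is_tree G) :
  exists F : set {ffun imset_index p -> R^o},
    is_face F (CIM R G) /\
    unimodularly_equivalent (STAB R (interior_graph G)) F.
Proof.
exists (@imset_lift R p G @` STAB R (interior_graph G))%classic; split.
  rewrite conv_hull_image ?stable_images_saturated //; last first.
    exact: imset_lift_affine.
  (* The bound is 0: by [dotv_face_form] the form is minus a sum of 0/1 terms. *)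
  apply: conv_hull_face => _ [d [_ sk] <-].
  rewrite dotv_face_form // ?oppr_le0 ?sumr_ge0 //.
  by move=> x y xy; rewrite -sk /skeleton xy.
apply: unimodularly_equivalent_image.
- exact: imset_lift_affine.
- exact: imset_lift_inj.
- by move=> x; apply: imset_lift_lattice.
Qed.
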